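(* Let $m\ge0$ be a fixed integer. As $n\to\infty$, the probability that a grand zigzag knight's path chosen uniformly at random among all grand zigzag knight's paths of size $n$ stays above the line $y=-m$ is asymptotically equivalent to $c_m/\sqrt n$, where $$c_m=\begin{cases}\dfrac{2+\sqrt5}{2}\sqrt{\dfrac{7\sqrt5-15}{\pi}}, & \text{if } m=0,\\[2ex] \dfrac{4m+3-\sqrt5}{4(\sqrt5-2)}\sqrt{\dfrac{7\sqrt5-15}{\pi}}, & \text{if } m\ge1.\end{cases}$$
   Context: A grand zigzag knight's path is a lattice path in $\mathbb{Z}^2$ starting at the origin, made of steps $N=(1,2)$, $\bar N=(1,-2)$, $E=(2,1)$, $\bar E=(2,-1)$, such that the vertical components of two consecutive steps never have the same direction (up-steps $N,E$ and down-steps $\bar N,\bar E$ alternate). The size is the $x$-coordinate of the last point. A path stays above the line $y=-m$ if all its points have $y$-coordinate $\ge -m$ (points on the line are allowed). *)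

(* Defs.v *)
From HB Require Import structures.
From mathcomp Require Import all_boot all_order all_algebra.
From mathcomp Require Import all_classical all_reals all_analysis.
Set Implicit Arguments.
Unset Strict Implicit.
Unset Printing Implicit Defensive.
Import Order.TTheory GRing.Theory Num.Theory.
Import numFieldNormedType.Exports.
Local Open Scope ring_scope.

(* A trailing b stands for the bar: stepNb and stepEb are the down-steps. *)
Inductive step := stepN | stepNb | stepE | stepEb.

Definition step_code (s : step) : bool * bool :=
  match s with
  | stepN => (true, true) | stepNb => (true, false)
  | stepE => (false, true) | stepEb => (false, false)
  end.

Definition step_decode (c : bool * bool) : step :=
  match c with
  | (true, true) => stepN | (true, false) => stepNb
  | (false, true) => stepE | (false, false) => stepEb
  end.

Lemma step_codeK : cancel step_code step_decode.
Proof. by case. Qed.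

HB.instance Definition _ := Finite.copy step (can_type step_codeK).

Definition step_vec (s : step) : int * int :=
  match s with
  | stepN => (1, 2) | stepNb => (1, - 2)
  | stepE => (2, 1) | stepEb => (2, - 1)
  end.

Definition is_up (s : step) : bool := 0 < (step_vec s).2.

Definition path_points (p : seq step) : seq (int * int) :=
  (0, 0) :: scanl (fun q s => (q.1 + (step_vec s).1, q.2 + (step_vec s).2))
                  (0, 0) p.

Definition path_size (p : seq step) : int := (last (0, 0) (path_points p)).1.

Definition grand_zigzag (p : seq step) : bool :=
  sorted (fun s t => is_up s != is_up t) p.

Definition stays_above (m : nat) (p : seq step) : bool :=
  all (fun q => - m%:Z <= q.2) (path_points p).

Lemma length_le_path_size (p : seq step) : (size p)%:Z <= path_size p.
Proof.
rewrite /path_size /=.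
suff H (q : int * int) : q.1 + (size p)%:Z <=
    (last q (scanl (fun q s => (q.1 + (step_vec s).1, q.2 + (step_vec s).2))
                   q p)).1 by have := H (0, 0); rewrite add0r.
elim: p q => [|s p IHp] q /=; first by rewrite addr0.
by apply: le_trans (IHp _); rewrite /= -addn1 PoszD [_ + 1]addrC addrA lerD2r
  lerD2l; case: s.
Qed.

(* By length_le_path_size, the bound n on the number of steps excludes no path
   of size n; it only serves to work in a finite type. *)
Definition gz_paths (n : nat) : {set n.-bseq step} :=
  [set p : n.-bseq step | grand_zigzag p && (path_size p == n%:Z)].

Definition prob_above (R : realType) (m n : nat) : R :=
  #|[set p in gz_paths n | stays_above m p]|%:R / #|gz_paths n|%:R.

Definition c_ (R : realType) (m : nat) : R :=
  let K := Num.sqrt ((7 * Num.sqrt 5 - 15) / pi) in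
  if m == 0%N then (2 + Num.sqrt 5) / 2 * K
  else (4 * m%:R + 3 - Num.sqrt 5) / (4 * (Num.sqrt 5 - 2)) * K.

(* Main.v *)
Require Import Defs.
From HB Require Import structures.
From mathcomp Require Import all_boot all_order all_algebra.
From mathcomp Require Import all_classical all_reals all_analysis.
From mathcomp Require Import ring lra zify.
Set Implicit Arguments.
Unset Strict Implicit.
Unset Printing Implicit Defensive.
Import Order.TTheory GRing.Theory Num.Theory.
Import numFieldNormedType.Exports.

(* Since a path alternates up- and down-steps, it can be read in (up, down)
   pairs, which change the height by 0, 1 or -1: up to its first and last steps
   it is a weighted Motzkin path. Let rho = (sqrt 5 - 1) / 2, so that
   rho + rho^2 = 1, and z = rho w. With coefficients scaled by rho^n, the
   generating functions U_h of the paths starting up from height h and staying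
   nonnegative satisfy a linear system that determines them, solved by
     U_h = (1 + z + z^2) (1 + r + ... + r^h) B,   r = 1 - D B,
     1 + 2 z^3 B = sqrt (E / D),
     D = 1 - (z + z^2)^2,   E = 1 - (z - z^2)^2.
   Here sqrt (E / D) is a polynomial times real series (1 - (x w)^d)^(-1/2), all
   with 0 < x < 1 except (1 - w^2)^(-1/2). Hence its coefficients are, by Wallis'
   formula and dominated convergence, equivalent to a constant times n^(-1/2).
   The system then gives by induction that the coefficients of U_h are
   equivalent to h + 1 times those of U_0, while the total number of paths is
   twice a Fibonacci number. *)

Local Open Scope ring_scope.

(** * Counting paths *)

Definition long_step (u : bool) : step := if u then stepN else stepNb.
Definition short_step (u : bool) : step := if u then stepE else stepEb.

(* Zigzag paths of size [n] from height [y], going up first iff [u]; the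
   predicate [ok] is not imposed on the starting height [y]. *)
Fixpoint zigzags (ok : pred int) (u : bool) (y : int) (n : nat) :
    seq (seq step) :=
  match n with
  | 0 => [:: [::]]
  | n1.+1 =>
    (let y1 := y + (step_vec (long_step u)).2 in
     if ok y1 then [seq long_step u :: p | p <- zigzags ok (~~ u) y1 n1]
     else [::]) ++
    (if n1 is n2.+1 then
       let y2 := y + (step_vec (short_step u)).2 in
       if ok y2 then [seq short_step u :: p | p <- zigzags ok (~~ u) y2 n2]
       else [::]
     else [::])
  end.

Definition step_len (s : step) : nat :=
  match s with stepN | stepNb => 1 | _ => 2 end.

Definition zz_len (p : seq step) : nat := sumn (map step_len p).

Fixpoint heights_ok (ok : pred int) (y : int) (p : seq step) : bool :=
  if p is s :: p' then
    ok (y + (step_vec s).2) && heights_ok ok (y + (step_vec s).2) p'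
  else true.

Definition starts (u : bool) (p : seq step) : bool :=
  if p is s :: _ then is_up s == u else true.

Lemma path_sizeE p : path_size p = (zz_len p)%:Z.
Proof.
rewrite /path_size /=.
suff H (q : int * int) : (last q (scanl (fun q s =>
    (q.1 + (step_vec s).1, q.2 + (step_vec s).2)) q p)).1 = q.1 + (zz_len p)%:Z.
  by rewrite H add0r.
elim: p q => [|s p IH] q /=; first by rewrite addr0.
rewrite IH /= /zz_len /= PoszD addrA; congr (_ + _ + _).
by case: s.
Qed.

Lemma stays_aboveE m p : stays_above m p = heights_ok (fun y => - m%:Z <= y) 0 p.
Proof.
rewrite /stays_above /= oppr_le0 lez_nat leq0n /=.
suff H (q : int * int) : all (fun q => - m%:Z <= q.2) (scanl (fun q s =>
    (q.1 + (step_vec s).1, q.2 + (step_vec s).2)) q p) =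
    heights_ok (fun y => - m%:Z <= y) q.2 p by rewrite H.
by elim: p q => //= s p IH q; rewrite IH.
Qed.

Lemma grand_zigzag_cons s p :
  grand_zigzag (s :: p) = starts (~~ is_up s) p && grand_zigzag p.
Proof. by case: p => //= t p; case: (is_up s); case: (is_up t). Qed.

Lemma mem_map_cons (T : eqType) (x y : T) s (L : seq (seq T)) :
  (y :: s \in [seq x :: p | p <- L]) = (y == x) && (s \in L).
Proof.
apply/mapP/andP => [[p pL [-> ->]]|[/eqP -> sL]]; first by rewrite eqxx.
by exists s.
Qed.

(** With [uniq_zigzags], this replaces cardinalities of sets of paths by lengths of lists, which
    obey a recursion on the size. *)
Lemma mem_zigzags ok u y n p :
  (p \in zigzags ok u y n) =
  [&& starts u p, grand_zigzag p, zz_len p == n & heights_ok ok y p].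
Proof.
elim: p u y n => [|s p IH] u y [|n] //.
- rewrite /= mem_cat; apply/negbTE; rewrite negb_or; apply/andP; split.
    by case: ifP => // _; apply/mapP => -[].
  by case: n => // n; case: ifP => // _; apply/mapP => -[].
- by rewrite [LHS]/= inE /=; symmetry; apply/negbTE; case: s; rewrite /= !andbF.
rewrite grand_zigzag_cons.
have E u' y' n' (b : bool) : (s :: p \in (if b then
    [seq u' :: p | p <- zigzags ok (~~ u) y' n'] else [::])) =
    [&& b, s == u', starts (~~ u) p, grand_zigzag p, zz_len p == n' &
      heights_ok ok y' p].
  by case: b => //; rewrite mem_map_cons IH.
rewrite [LHS]/= mem_cat E.
case: n => [|n].
  rewrite in_nil orbF.
  case: s {E}; case: u; rewrite /= ?andbF //= /zz_len /= -?andbA ?add1n ?add2n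
    ?eqSS ?andbF //;
    case: (ok _); rewrite ?andbF ?orbF //.
rewrite E.
case: s {E}; case: u; rewrite /= ?andbF ?orbF //= /zz_len /= -?andbA ?add1n
  ?add2n ?eqSS ?andbF //;
    case: (ok _); rewrite ?andbF ?orbF //.
Qed.

Lemma uniq_zigzags ok u y n : uniq (zigzags ok u y n).
Proof.
have [k] := ubnP n; elim: k => // k IH in u y n *; case: n => // n lt_nk.
have U (b : bool) s y' n' : (n' < k)%N ->
    uniq (if b then [seq s :: p | p <- zigzags ok (~~ u) y' n'] else [::]).
  move=> ?; case: b => //; rewrite map_inj_uniq; last by move=> ? ? [].
  exact: IH.
rewrite /= cat_uniq U //=; apply/andP; split.
  case: n lt_nk => // n lt_nk; apply/hasPn => p; case: ifP => // _ /mapP[q _ ->].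
  by case: ifP => // _; rewrite mem_map_cons; case: u {U}.
by case: n lt_nk => // n lt_nk; apply: U; apply: ltnW.
Qed.

Lemma card_bseq (T : finType) (n : nat) (P : pred (seq T)) (L : seq (seq T)) :
  uniq L -> (forall p, (p \in L) = (size p <= n)%N && P p) ->
  #|[set p : n.-bseq T | P p]| = size L.
Proof.
move=> uL memL; rewrite cardE -(size_map (@bseqval n T)); apply: perm_size;
  apply: uniq_perm => //.
  by rewrite (map_inj_uniq val_inj) enum_uniq.
move=> p; rewrite memL; apply/mapP/andP => [[q]|[sp Pp]].
  by rewrite mem_enum inE => Pq ->; rewrite size_bseq.
by exists (Bseq sp) => //; rewrite mem_enum inE.
Qed.

Lemma card_zigzags ok n : (0 < n)%N ->
  #|[set p : n.-bseq step | [&& grand_zigzag p, path_size p == n%:Z &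
    heights_ok ok 0 p]]| =
  (size (zigzags ok true 0 n) + size (zigzags ok false 0 n))%N.
Proof.
move=> n0; rewrite -size_cat; apply: (@card_bseq _ _ (fun p =>
  [&& grand_zigzag p, path_size p == n%:Z & heights_ok ok 0 p])).
  (* A nonempty path has one initial direction; only the empty path, of size 0, would occur in both
     lists. *)
  rewrite cat_uniq !uniq_zigzags andbT /=; apply/hasPn => p.
  rewrite !mem_zigzags; case: p => [|s p]; first by case: n n0.
  by case/andP => /eqP /= ->.
move=> p; rewrite mem_cat !mem_zigzags path_sizeE eqz_nat.
have [/eqP zp|] := boolP (zz_len p == n); last by rewrite !andbF.
have -> : (size p <= n)%N by rewrite -zp -lez_nat -path_sizeE length_le_path_size.
case: p zp => [|s p] _; first by rewrite orbb.
by rewrite /starts; case: (is_up s); rewrite ?orbF.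
Qed.

(** Compositions of n into parts 1 and 2, a Fibonacci number. Once its initial direction is fixed,
    an unconstrained zigzag path is determined by the lengths of its steps. *)
Fixpoint compositions (n : nat) : nat :=
  match n with
  | 0 => 1
  | n1.+1 => compositions n1 + (if n1 is n2.+1 then compositions n2 else 0)
  end.

Lemma compositions_gt0 n : (0 < compositions n)%N.
Proof. by elim: n => //= n IH; rewrite addn_gt0 IH. Qed.

(* Zigzag paths of size [n] from height [h] that stay nonnegative, going up
   first iff [u]; see [size_zigzags_above]. *)
Fixpoint nonneg_count (u : bool) (h n : nat) : nat :=
  match n with
  | 0 => 1
  | n1.+1 =>
    (if u then nonneg_count false h.+2 n1
     else if h is h'.+2 then nonneg_count true h' n1 else 0) +
    (if n1 is n2.+1 then
       if u then nonneg_count false h.+1 n2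
       else if h is h'.+1 then nonneg_count true h' n2 else 0
     else 0)
  end.

Lemma nonneg_count_upSS h n : nonneg_count true h n.+2 =
  (nonneg_count false h.+2 n.+1 + nonneg_count false h.+1 n)%N.
Proof. by []. Qed.

Lemma nonneg_count_downSS h n : nonneg_count false h.+2 n.+2 =
  (nonneg_count true h n.+1 + nonneg_count true h.+1 n)%N.
Proof. by []. Qed.

Lemma nonneg_count_down1 n :
  nonneg_count false 1 n.+2 = nonneg_count true 0 n.
Proof. by []. Qed.

Lemma size_zigzags_all u y n : size (zigzags predT u y n) = compositions n.
Proof.
have [k] := ubnP n; elim: k => // k IH in u y n *; case: n => // n lt_nk.
rewrite /= size_cat size_map IH //; congr (_ + _)%N.
by case: n lt_nk => // n lt_nk; rewrite size_map IH // ltnW.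
Qed.

Lemma size_zigzags_above m u y h n : y = h%:Z - m%:Z ->
  size (zigzags (fun y => - m%:Z <= y) u y n) = nonneg_count u h n.
Proof.
have [k] := ubnP n; elim: k => // k IH in u y h n *; case: n => // n lt_nk def_y.
rewrite /= size_cat; congr (_ + _)%N.
  case: u => /=; first by rewrite ifT ?size_map; [apply: IH => //; lia | lia].
  case: h def_y => [|[|h]] def_y; [by rewrite ifF //; lia | by rewrite ifF //;
    lia |].
  rewrite ifT ?size_map; [apply: IH => //; lia | lia].
case: n lt_nk => // n /ltnW lt_nk.
case: u => /=; first by rewrite ifT ?size_map; [apply: IH => //; lia | lia].
case: h def_y => [|h] def_y; [by rewrite ifF //; lia |].
rewrite ifT ?size_map; [apply: IH => //; lia | lia].
Qed.

Lemma prob_aboveE (R : realType) m n : (0 < n)%N ->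
  prob_above R m n = (nonneg_count true m n + nonneg_count false m n)%:R /
                     (compositions n).*2%:R.
Proof.
move=> n0; rewrite /prob_above.
have -> : #|[set p in gz_paths n | stays_above m p]| =
    (nonneg_count true m n + nonneg_count false m n)%N.
  rewrite -!(@size_zigzags_above m _ 0); try by rewrite subrr.
  rewrite -card_zigzags //; apply: eq_card => p.
  by rewrite !inE stays_aboveE -andbA.
have -> // : #|gz_paths n| = (compositions n).*2.
rewrite -addnn -{1}(size_zigzags_all true 0) -(size_zigzags_all false 0).
rewrite -card_zigzags //; apply: eq_card => p; rewrite !inE.
have -> : heights_ok predT 0 p by elim: (val p) (0 : int) => //= s q IH y;
  exact: IH.
by rewrite andbT.
Qed.

Local Open Scope classical_set_scope.

(** * Formal power series *)

Definition fps (R : comNzRingType) := nat -> R.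

Section FpsRing.
Variable R : comNzRingType.
Implicit Types a b c : fps R.

HB.instance Definition _ := gen_eqMixin (fps R).
HB.instance Definition _ := gen_choiceMixin (fps R).

Definition fps_add a b : fps R := fun n => a n + b n.
Definition fps_opp a : fps R := fun n => - a n.
Definition fps_const (x : R) : fps R := fun n => if n == 0%N then x else 0.
Definition fps_mul a b : fps R := fun n => \sum_(i < n.+1) a i * b (n - i)%N.

Fact fps_addA : associative fps_add.
Proof. by move=> a b c; apply/funext => n; exact: addrA. Qed.
Fact fps_addC : commutative fps_add.
Proof. by move=> a b; apply/funext => n; exact: addrC. Qed.
Fact fps_add0 : left_id (fps_const 0) fps_add.
Proof. by move=> a; apply/funext => n;
  rewrite /fps_add /fps_const if_same add0r. Qed.
Fact fps_addN : left_inverse (fps_const 0) fps_opp fps_add.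
Proof.
by move=> a; apply/funext => n; rewrite /fps_add /fps_const if_same addNr.
Qed.

HB.instance Definition _ :=
  GRing.isZmodule.Build (fps R) fps_addA fps_addC fps_add0 fps_addN.

(** Low coefficients of a product only see truncations of the factors, so commutativity and
    associativity carry over from polynomials. *)
Fact fps_mul_poly (n : nat) (a b : fps R) (i : nat) : (i < n)%N ->
  fps_mul a b i = ((\poly_(j < n) a j) * (\poly_(j < n) b j))`_i.
Proof.
move=> lt_in; rewrite coefM; apply: eq_bigr => j _.
rewrite !coef_poly (leq_ltn_trans (leq_subr _ _) lt_in).
by rewrite (leq_ltn_trans _ lt_in) // -ltnS.
Qed.

Fact fps_mulC : commutative fps_mul.
Proof. by move=> a b; apply/funext => n;
  rewrite !(@fps_mul_poly n.+1) // mulrC. Qed.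

Fact fps_mulA : associative fps_mul.
Proof.
have E a b c n : fps_mul a (fps_mul b c) n =
    ((\poly_(j < n.+1) a j) * ((\poly_(j < n.+1) b j) * (\poly_(j < n.+1) c
      j)))`_n.
  rewrite (@fps_mul_poly n.+1) // !coefM; apply: eq_bigr => i _.
  by rewrite (coef_poly n.+1 (fps_mul b c)) ltnS leq_subr (@fps_mul_poly n.+1)
    // ltnS leq_subr.
move=> a b c; apply/funext => n.
by rewrite (fps_mulC (fps_mul a b)) !E mulrA mulrC.
Qed.

Fact fps_mul1 : left_id (fps_const 1) fps_mul.
Proof.
move=> a; apply/funext => n; rewrite /fps_mul big_ord_recl big1 ?addr0.
  by rewrite mul1r subn0.
by move=> i _; rewrite mul0r.
Qed.

Fact fps_mulDl : left_distributive fps_mul fps_add.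
Proof.
move=> a b c; apply/funext => n; rewrite /fps_mul /fps_add -big_split /=.
by apply: eq_bigr => i _; rewrite mulrDl.
Qed.

Fact fps_oner_neq0 : fps_const 1 != 0.
Proof. by apply/eqP => /(congr1 (fun a : fps R => a 0%N));
  apply/eqP/oner_neq0. Qed.

HB.instance Definition _ := GRing.Zmodule_isComNzRing.Build (fps R)
  fps_mulA fps_mulC fps_mul1 fps_mulDl fps_oner_neq0.

Lemma fpsP a b : a =1 b -> a = b.
Proof. by move/funext. Qed.

Lemma fpsD a b n : (a + b) n = a n + b n. Proof. by []. Qed.
Lemma fpsN a n : (- a) n = - a n. Proof. by []. Qed.
Lemma fps0E n : (0 : fps R) n = 0.
Proof. by case: n. Qed.
Lemma fps1E n : (1 : fps R) n = if n == 0%N then 1 else 0. Proof. by []. Qed.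
Lemma fpsME a b n : (a * b) n = \sum_(i < n.+1) a i * b (n - i)%N.
Proof. by []. Qed.

Lemma fps_constM x a n : (fps_const x * a) n = x * a n.
Proof.
rewrite fpsME big_ord_recl big1 ?addr0 ?subn0 // => i _.
by rewrite mul0r.
Qed.

Lemma fps_constE x n : fps_const x n = if n == 0%N then x else 0. Proof. by [].
  Qed.

Fact fps_const_zmod : zmod_morphism fps_const.
Proof.
by move=> x y; apply/funext => -[|n]; rewrite !(fpsD,fpsN, fps_constE) // subr0.
Qed.
Fact fps_const_monoid : monoid_morphism fps_const.
Proof.
split=> // x y; apply/funext => n; rewrite fps_constM !fps_constE.
by case: eqP => // _; rewrite mulr0.
Qed.
HB.instance Definition _ := GRing.isZmodMorphism.Build R (fps R) fps_const
  fps_const_zmod.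
HB.instance Definition _ := GRing.isMonoidMorphism.Build R (fps R) fps_const
  fps_const_monoid.

Definition fpsX : fps R := fun n => if n == 1%N then 1 else 0.

Lemma fpsXM a n : (fpsX * a) n = if n is n'.+1 then a n' else 0.
Proof.
rewrite fpsME; case: n => [|n]; first by rewrite big_ord1 mul0r.
rewrite big_ord_recl mul0r add0r big_ord_recl mul1r subSS subn0 big1 ?addr0 //.
by move=> i _; rewrite mul0r.
Qed.

Lemma fpsXnM a d n : (fpsX ^+ d * a) n = if (d <= n)%N then a (n - d)%N else 0.
Proof.
elim: d n => [|d IH] n; first by rewrite mul1r subn0.
by rewrite exprS -mulrA fpsXM; case: n => // n; rewrite IH.
Qed.

(** The derivation w d/dw, which unlike d/dw shifts no index; in characteristic 0 its kernel is the
    constants. *)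
Definition euler a : fps R := fun n => n%:R * a n.

Lemma eulerD a b : euler (a + b) = euler a + euler b.
Proof. by apply/fpsP => n; rewrite /euler !fpsD mulrDr. Qed.

Lemma eulerM a b : euler (a * b) = euler a * b + a * euler b.
Proof.
apply/fpsP => n; rewrite /euler fpsD !fpsME mulr_sumr -big_split /=.
apply: eq_bigr => i _; have le_in : (i <= n)%N by rewrite -ltnS.
rewrite -{1}(subnKC le_in) natrD; ring.
Qed.

Lemma euler_const x : euler (fps_const x) = 0.
Proof. by apply/fpsP => -[|n]; rewrite fps0E /euler ?mul0r ?mulr0. Qed.

Lemma eulerXn d : euler (fpsX ^+ d) = fps_const d%:R * fpsX ^+ d.
Proof.
apply/fpsP => n; rewrite fps_constM -[fpsX ^+ d]mulr1 /euler !fpsXnM.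
case: leqP => [le_dn|]; last by rewrite !mulr0.
rewrite fps1E subn_eq0; case: leqP => [le_nd|]; last by rewrite !mulr0.
by have -> : n = d by apply/eqP; rewrite eqn_leq le_nd.
Qed.

End FpsRing.
Arguments fps_const {R}.
Arguments fpsX {R}.

(** * Wallis' formula *)

Section Wallis.
Variable R : realType.

(* The reduction formula of the Wallis integrals, taken as a definition: the
   integrals are then only values of an explicit antiderivative. *)
Fixpoint sin_prim (n : nat) (x : R) : R :=
  match n with
  | 0%N => x
  | 1%N => 1 - cos x
  | n'.+2 => (n'.+1%:R * sin_prim n' x - sin x ^+ n'.+1 * cos x) / n'.+2%:R
  end.

Lemma sin_prim_derive n (x : R) : is_derive x 1 (sin_prim n) (sin x ^+ n).
Proof.
suff: is_derive x 1 (sin_prim n) (sin x ^+ n) /\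
      is_derive x 1 (sin_prim n.+1) (sin x ^+ n.+1) by case.
elim: n => [|n [IH0 IH1]]; split=> //.
- by rewrite expr0; exact: is_derive_id.
- have -> : sin_prim 1 = cst 1 - cos by apply/funext.
  by apply: is_derive_eq; rewrite expr1 sub0r opprK.
have -> : sin_prim n.+2 =
    n.+2%:R^-1 *: (n.+1%:R *: sin_prim n - (sin ^+ n.+1) * cos).
  by apply/funext => y /=; rewrite !fctE mulrC.
apply: is_derive_eq.
rewrite /= /GRing.scale /=.
have -> : (sin ^+ n.+1) x = sin x ^+ n.+1 by rewrite fctE.
have c2 : cos x * cos x = 1 - sin x * sin x.
  by rewrite -!expr2; apply: cos2sin2.
rewrite -!natr1.
have n2 : (n%:R + 1 + 1 : R) != 0 by rewrite !natr1 pnatr_eq0.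
apply: (mulfI n2); rewrite mulVKf // !exprS.
transitivity ((n%:R + 1) * sin x ^+ n - ( - (sin x * sin x ^+ n) * sin x +
  (n%:R + 1) * sin x ^+ n * (cos x * cos x))); first by ring.
rewrite c2; ring.
Qed.

Lemma sin_prim0 n : sin_prim n 0 = 0.
Proof.
suff: sin_prim n 0 = 0 /\ sin_prim n.+1 0 = 0 by case.
elim: n => [|n [IH0 IH1]]; split=> //=; first by rewrite cos0 subrr.
by rewrite IH0 sin0 expr0n mulr0 mul0r subrr mul0r.
Qed.

Lemma sin_prim_pihalfS n :
  sin_prim n.+2 (pi / 2) = n.+1%:R / n.+2%:R * sin_prim n (pi / 2).
Proof. by rewrite /= cos_pihalf mulr0 subr0 mulrAC. Qed.

(** The difference of the two antiderivatives vanishes at 0 and has derivative sin^n (1 - sin),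
    nonnegative on [0, pi / 2]. *)
Lemma sin_prim_pihalf_le n : sin_prim n.+1 (pi / 2) <= sin_prim n (pi / 2).
Proof.
rewrite -subr_ge0.
have -> : 0 = (sin_prim n - sin_prim n.+1) 0 by rewrite !fctE !sin_prim0 subrr.
have H (x : R) : is_derive x 1 (sin_prim n - sin_prim n.+1) (sin x ^+ n * (1 -
  sin x)).
  have H0 := @sin_prim_derive n x; have H1 := @sin_prim_derive n.+1 x.
  by apply: is_derive_eq; rewrite mulrBr mulr1 exprSr.
have pi2 : 0 <= (pi : R) / 2 by rewrite divr_ge0 // pi_ge0.
apply: (@ger0_derive1_ndecr _ _ 0 (pi / 2)) => //.
- move=> x; rewrite in_itv /= => /andP[x0 x1].
  rewrite derive1E derive_val mulr_ge0 // ?exprn_ge0 ?subr_ge0 ?sin_le1 //.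
  apply: sin_ge0_pi; rewrite (ltW x0) /= (le_trans (ltW x1)) //.
  by rewrite ler_pdivrMr // ler_peMr ?pi_ge0 // ler1n.
- by apply: derivable_within_continuous => x _.
Qed.

(* The central binomial ratio 'C(2 k, k) / 4 ^ k. *)
Fixpoint cbin (k : nat) : R :=
  if k is k'.+1 then cbin k' * k'.*2.+1%:R / k'.+1.*2%:R else 1.

Lemma cbinS k : cbin k.+1 = cbin k * k.*2.+1%:R / k.+1.*2%:R.
Proof. by []. Qed.

Lemma cbin_gt0 k : 0 < cbin k.
Proof. by elim: k => //= k IH; rewrite divr_gt0 ?mulr_gt0 // ltr0n. Qed.

Lemma cbin_le1 k : cbin k <= 1.
Proof.
elim: k => //= k IH; rewrite ler_pdivrMr ?ltr0n // mul1r.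
apply: le_trans (_ : 1 * k.*2.+1%:R <= _); first by rewrite ler_wpM2r.
by rewrite mul1r ler_nat.
Qed.

Lemma sin_prim_even k : sin_prim k.*2 (pi / 2) = pi / 2 * cbin k.
Proof.
elim: k => [|k IH]; first by rewrite mulr1.
rewrite doubleS sin_prim_pihalfS IH cbinS doubleS; ring.
Qed.

Lemma cbin_sin_prim_odd k : cbin k * sin_prim k.*2.+1 (pi / 2) = k.*2.+1%:R^-1.
Proof.
elim: k => [|k IH]; first by rewrite /= cos_pihalf subr0 mulr1 invr1.
rewrite doubleS sin_prim_pihalfS cbinS doubleS.
transitivity (k.*2.+1%:R / k.*2.+3%:R * (k.*2.+2%:R / k.*2.+2%:R)
   * (cbin k * sin_prim k.*2.+1 (pi / 2))); first by ring.
rewrite IH mulfV ?pnatr_eq0 // mulr1 mulrAC mulfV ?pnatr_eq0 // mul1r //.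
Qed.

(** Monotonicity of the Wallis integrals from 2k to 2k+1; the step from 2k+1 to 2k+2 gives the upper
    bound [cbin_sqr_le]. *)
Lemma cbin_sqr_ge k : 2 / pi / k.*2.+1%:R <= cbin k ^+ 2.
Proof.
have pi0 := pi_gt0 R.
rewrite -cbin_sin_prim_odd mulrCA expr2 ler_pM2l ?cbin_gt0 //.
apply: le_trans (_ : 2 / pi * (pi / 2 * cbin k) <= _).
  by rewrite ler_pM2l ?divr_gt0 // -sin_prim_even sin_prim_pihalf_le.
by rewrite le_eqVlt mulrA -[_ / _]invf_div mulVf ?mul1r ?eqxx // mulf_neq0
  ?invr_eq0 ?gt_eqF.
Qed.

Lemma cbin_sqr_le k : cbin k ^+ 2 <= 2 / pi * k.+1.*2%:R / k.*2.+1%:R ^+ 2.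
Proof.
have pi0 := pi_gt0 R.
have E : cbin k * cbin k.+1 <= 2 / pi / k.*2.+1%:R.
  rewrite -cbin_sin_prim_odd [leRHS]mulrCA ler_pM2l ?cbin_gt0 //.
  have -> : cbin k.+1 = 2 / pi * (pi / 2 * cbin k.+1).
    by rewrite mulrA -[2 / pi]invf_div mulVf ?mul1r // mulf_neq0 ?invr_eq0
      ?gt_eqF.
  by rewrite ler_pM2l ?divr_gt0 // -sin_prim_even doubleS sin_prim_pihalf_le.
apply: le_trans (_ : 2 / pi / k.*2.+1%:R * (k.+1.*2%:R / k.*2.+1%:R) <= _);
  last first.
  by rewrite le_eqVlt; apply/orP; left; apply/eqP; rewrite -exprVn; ring.
have n0 : 0 <= (k.+1.*2%:R / k.*2.+1%:R : R) by rewrite divr_ge0.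
apply: (le_trans _ (ler_wpM2r n0 E)).
rewrite le_eqVlt; apply/orP; left; apply/eqP.
have a0 : (k.*2.+1%:R : R) != 0 by rewrite pnatr_eq0.
have b0 : (k.+1.*2%:R : R) != 0 by rewrite pnatr_eq0.
rewrite cbinS; move: (k.*2.+1%:R) (k.+1.*2%:R) a0 b0 => a b a0 b0.
by field; rewrite a0 b0.
Qed.

Lemma cbin_half_cvg :
  (fun n => cbin n./2 * Num.sqrt n.+1%:R) @ \oo --> Num.sqrt (2 / pi : R).
Proof.
have pi0 := pi_gt0 R.
have E n : cbin n./2 * Num.sqrt n.+1%:R = Num.sqrt (cbin n./2 ^+ 2 * n.+1%:R).
  by rewrite sqrtrM ?sqr_ge0 // sqrtr_sqr ger0_norm // ltW ?cbin_gt0.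
under eq_fun do rewrite E.
apply: (@cvg_comp _ _ _ _ Num.sqrt _ (nbhs (2 / pi : R)));
  last exact: sqrt_continuous.
(* The squared sequence is squeezed between 2 / pi and (2 / pi) (1 + 8 / (n + 1)); the 8 leaves room
   for both parities of n. *)
have H : (fun n => 2 / pi + harmonic n * (16 / pi)) @ \oo --> (2 / pi : R).
  rewrite -[X in _ --> X]addr0 -[X in _ + X](mul0r (16 / pi)).
  by apply: cvgD; [exact: cvg_cst | apply: cvgMl; exact: cvg_harmonic].
apply: (squeeze_cvgr _ (cvg_cst _) H).
near=> n.
have b1 := cbin_sqr_ge n./2; have b2 := cbin_sqr_le n./2.
have k1 : (n./2.*2.+1 <= n.+1)%N by rewrite -[in leqRHS](odd_double_half n); lia.
have k2 : (n.+1 <= n./2.*2.+2)%N by rewrite -[in leqLHS](odd_double_half n);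
  case: odd; lia.
have d1 : (1 : R) <= n./2.*2.+1%:R by rewrite ler1n.
have N1 : (n./2.*2.+1%:R : R) <= n.+1%:R by rewrite ler_nat.
have N2 : (n.+1%:R : R) <= n./2.*2.+1%:R + 1 by rewrite natr1 ler_nat.
have p0 : 0 < 2 / (pi : R) by rewrite divr_gt0.
rewrite (_ : 16 / pi = 8 * (2 / pi)); last by ring.
rewrite doubleS -[n./2.*2.+2%:R]natr1 in b2.
rewrite /harmonic /=.
move: (n./2.*2.+1%:R : R) (n.+1%:R : R) (cbin n./2 ^+ 2) (2 / pi : R) d1 N1 N2
  p0 b1 b2.
move=> d N c p d1 N1 N2 p0 b1 b2.
have d0 : 0 < d by lra.
have N0 : 0 < N by lra.
rewrite ler_pdivrMr // in b1; rewrite ler_pdivlMr ?exprn_gt0 // in b2.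
have c0 : 0 <= c by rewrite -(pmulr_lge0 _ d0); lra.
apply/andP; split; first by apply: (le_trans b1); rewrite ler_wpM2l.
rewrite -(ler_pM2r (exprn_gt0 2 d0)) -(ler_pM2r N0).
have -> : (p + N^-1 * (8 * p)) * d ^+ 2 * N = p * (d ^+ 2 * (N + 8)).
  by field; rewrite gt_eqF.
have -> : c * N * d ^+ 2 * N = c * d ^+ 2 * N ^+ 2 by ring.
apply: (@le_trans _ _ (p * (d + 1) * N ^+ 2));
  first by rewrite ler_wpM2r ?sqr_ge0.
rewrite -mulrA ler_pM2l //.
have [e [e0 e1 ->]] : exists e, [/\ 0 <= e, e <= 1 & N = d + e].
  by exists (N - d); split; [lra|lra|ring].
have : 0 <= (1 - e) * d ^+ 2 by rewrite mulr_ge0 ?sqr_ge0 //; lra.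
have : 0 <= (1 - e) * d by rewrite mulr_ge0 //; lra.
have : 0 <= (1 - e) * (1 + e) by rewrite mulr_ge0 //; lra.
have : 0 <= (1 - e) * (1 + e) * d by rewrite !mulr_ge0 //; lra.
have : 0 <= (d - 1) * d by rewrite mulr_ge0 //; lra.
rewrite !exprS !expr0; lra.
Unshelve. all: by end_near.
Qed.
End Wallis.

(** * Coefficients equivalent to a constant times n^(-1/2) *)

Section Asymptotics.
Variable R : realType.
Implicit Types (a b : fps R) (L : R).

(** L = 0 is allowed and means o(n^(-1/2)), so that terms can be neglected additively; n + 1 keeps
    the root invertible at n = 0. *)
Definition asym a L := (fun n => a n * Num.sqrt (n.+1%:R : R)) @ \oo --> L.

Lemma asymD a b L L' : asym a L -> asym b L' -> asym (a + b) (L + L').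
Proof.
move=> ha hb; rewrite /asym; under eq_fun do rewrite fpsD mulrDl.
exact: cvgD.
Qed.

Lemma asymN a L : asym a L -> asym (- a) (- L).
Proof.
move=> ha; rewrite /asym; under eq_fun do rewrite fpsN mulNr.
exact: cvgN.
Qed.

Lemma asymZ x a L : asym a L -> asym (fps_const x * a) (x * L).
Proof.
move=> ha; rewrite /asym; under eq_fun do rewrite fps_constM -mulrA.
exact: cvgMr.
Qed.

Lemma asym_finite a (N : nat) : (forall n, (N <= n)%N -> a n = 0) -> asym a 0.
Proof.
move=> a0; apply: cvg_near_cst; near=> n; apply/eqP.
rewrite a0 ?mul0r //; near: n; exact: nbhs_infty_ge.
Unshelve. all: by end_near.
Qed.

Lemma cvg_sqrt_ratio :
  (fun n => Num.sqrt (n.+2%:R : R) / Num.sqrt n.+1%:R) @ \oo --> (1 : R).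
Proof.
have E n : Num.sqrt (n.+2%:R : R) / Num.sqrt n.+1%:R = Num.sqrt (1 + harmonic n).
  rewrite /harmonic /= -sqrtrV ?ler0n // -sqrtrM ?ler0n //; congr Num.sqrt.
  by rewrite -[in X in X / _]natr1 mulrDl mul1r mulfV // pnatr_eq0.
under eq_fun do rewrite E.
suff: (fun n => Num.sqrt (1 + harmonic n)) @ \oo --> Num.sqrt (1 : R) by
  rewrite sqrtr1.
apply: (@cvg_comp _ _ _ _ Num.sqrt _ (nbhs (1 : R))); last exact: sqrt_continuous.
have H : (fun n => 1 + harmonic n) @ \oo --> (1 + 0 : R).
  by apply: cvgD; [exact: cvg_cst | exact: cvg_harmonic].
by move: H; rewrite addr0.
Qed.

Lemma sqrtS_neq0 n : Num.sqrt (n.+1%:R : R) != 0.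
Proof. by rewrite gt_eqF // sqrtr_gt0 ltr0n. Qed.

(** A shift of indices keeps the constant because sqrt (n + 2) / sqrt (n + 1) tends to 1. The direct
    implication later allows division by powers of z. *)
Lemma asymX a L : asym (fpsX * a) L <-> asym a L.
Proof.
split=> h.
  have h' : (fun n => (fpsX * a) n.+1 * Num.sqrt (n.+2%:R : R)) @ \oo --> L.
    by move: h; rewrite /asym -(cvg_shiftS (fun n => (fpsX * a) n * _)).
  rewrite /asym; have -> : (fun n => a n * Num.sqrt (n.+1%:R : R)) =
      (fun n => (fpsX * a) n.+1 * Num.sqrt (n.+2%:R : R) *
       (Num.sqrt (n.+2%:R : R) / Num.sqrt n.+1%:R)^-1).
    apply/funext => n /=; rewrite fpsXM; field.
    by rewrite !sqrtS_neq0.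
  rewrite -[L]mulr1 -[X in L * X]invr1.
  exact: cvgM h' (cvgV (oner_neq0 _) cvg_sqrt_ratio).
rewrite /asym -(cvg_shiftS (fun n => (fpsX * a) n * _)) /=.
have -> : (fun n => (fpsX * a) n.+1 * Num.sqrt (n.+2%:R : R)) =
    ((fun n => a n * Num.sqrt (n.+1%:R : R)) \*
     (fun n => Num.sqrt (n.+2%:R : R) / Num.sqrt n.+1%:R)).
  apply/funext => n /=; rewrite fpsXM; field.
  by rewrite sqrtS_neq0.
rewrite -[L]mulr1; exact: cvgM h cvg_sqrt_ratio.
Qed.

Lemma asymXn d a L : asym (fpsX ^+ d * a) L <-> asym a L.
Proof.
elim: d => [|d IH]; first by rewrite mul1r.
by rewrite exprS -mulrA asymX.
Qed.

(** Dominated convergence for sums of growing length: below a fixed M finitely many terms converge,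
    beyond M the terms of f are bounded by the small tail of g. *)
Lemma tannery (f : nat -> nat -> R) (l g : nat -> R) :
  (forall i, (fun n => f n i) @ \oo --> l i) ->
  (forall n i, `|f n i| <= g i) -> cvgn (series g) ->
  (fun n => \sum_(0 <= i < n.+1) f n i) @ \oo --> limn (series l).
Proof.
move=> fl fg gcv.
have lg i : `|l i| <= g i.
  have h : (fun n => `|f n i|) @ \oo --> `|l i| by apply: cvg_norm.
  rewrite -(cvg_lim _ h) //; apply: limr_le; first by apply/cvg_ex; eexists;
    exact: h.
  exact: nearW.
have lcv : cvgn (series l).
  apply: normed_cvg; apply: (series_le_cvg _ _ _ gcv) => n //.
  - exact: normr_ge0.
  - exact: le_trans (normr_ge0 _) (lg n).
  - exact: lg.
apply/cvgrPdist_le => e e0.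
(* One quarter each for the tail of l and for the terms below M, two for the tail of g, a difference
   of two partial sums near their limit. *)
have e4 : 0 < e / 4 by rewrite divr_gt0.
have /cvgrPdist_le /(_ _ e4) [N _ hN] := gcv.
have /cvgrPdist_le /(_ _ e4) [N' _ hN'] := lcv.
pose M := maxn N N'.
have tail n : (M <= n)%N -> \sum_(M <= i < n) g i <= e / 4 + e / 4.
  move=> Mn; rewrite -(@sub_series_geq _ g) //.
  have := hN M (leq_maxl _ _); have := hN n (leq_trans (leq_maxl _ _) Mn).
  rewrite /= !ler_norml => /andP[h1 h2] /andP[h3 h4]; lra.
have hd K : (fun n => \sum_(0 <= i < K) f n i) @ \oo --> \sum_(0 <= i < K) l i.
  elim: K => [|K IH]; first by under eq_fun do rewrite big_geq //;
    rewrite big_geq //; exact: cvg_cst.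
  rewrite big_nat_recr //=; under eq_fun do rewrite big_nat_recr //=.
  exact: cvgD IH (fl K).
have /cvgrPdist_le /(_ _ e4) [N1 _ hN1] := hd M.
near=> n.
have Mn : (M <= n.+1)%N by apply: leqW; near: n; exact: nbhs_infty_ge.
rewrite (big_cat_nat (leq0n M) Mn) /=.
have A1 := hN1 n _; have {}A1 : `|\sum_(0 <= i < M) l i - \sum_(0 <= i < M) f n
  i| <= e / 4.
  by apply: A1; rewrite /=; near: n; exact: nbhs_infty_ge.
have A2 := hN' M (leq_maxr _ _).
have A3 : `|\sum_(M <= i < n.+1) f n i| <= e / 4 + e / 4.
  apply: le_trans (tail _ Mn); apply: le_trans (ler_norm_sum _ _ _) _.
  by apply: ler_sum => i _; exact: fg.
have -> : limn (series l) - (\sum_(0 <= i < M) f n i + \sum_(M <= i < n.+1) f n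
  i) =
  (limn (series l) - series l M) + (\sum_(0 <= i < M) l i - \sum_(0 <= i < M) f
    n i)
   - \sum_(M <= i < n.+1) f n i by rewrite /series /=; ring.
apply: le_trans (ler_normB _ _) _.
apply: le_trans (lerD (ler_normD _ _) (lexx _)) _.
move: A1 A2 A3 => /=; lra.
Unshelve. all: by end_near.
Qed.

Lemma cvg_arith_geom (t : R) : 0 <= t -> t < 1 ->
  cvgn (series (fun i => i.+1%:R * t ^+ i)).
Proof.
move=> t0 t1.
have u0 : 0 < 1 - t by rewrite subr_gt0.
apply: nondecreasing_is_cvgn.
  apply/nondecreasing_series => i _ _; rewrite mulr_ge0 ?exprn_ge0 //.
exists ((1 - t) ^- 2) => _ [n _ <-].
have E : series (fun i => i.+1%:R * t ^+ i) n * (1 - t) ^+ 2 =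
    1 - n.+1%:R * t ^+ n + n%:R * t ^+ n.+1.
  rewrite /series /=; elim: n => [|n IH].
    by rewrite big_geq // mul0r mul0r !mul1r expr0 subrr addr0.
  rewrite big_nat_recr //= mulrDl IH -!natr1 !exprS; ring.
rewrite -[X in _ <= X]mul1r ler_pdivlMr ?exprn_gt0 // E.
rewrite -natr1 exprS.
have h1 : 0 <= n%:R * t ^+ n * (1 - t) by rewrite !mulr_ge0 ?exprn_ge0 // ltW.
have h2 : 0 <= t ^+ n by rewrite exprn_ge0.
lra.
Qed.

(** [tannery] on the Cauchy product: the i-th term tends to k_i L, and sqrt (n + 1) <= (i + 1) sqrt
    (n - i + 1) yields the summable bound M (i + 1) t^i. *)
Lemma asym_mul (a k : fps R) (L t : R) : 0 <= t -> t < 1 ->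
  (forall n, `|k n| <= t ^+ n) -> asym a L ->
  asym (k * a) (L * limn (series k)).
Proof.
move=> t0 t1 kt ha.
have [M M0 hM] : exists2 M, 0 <= M & forall n, `|a n * Num.sqrt (n.+1%:R : R)|
  <= M.
  have /pinfty_ex_gt0 [M M0 hM] := cvg_seq_bounded (cvgP _ ha).
  by exists M => [|n]; [exact: ltW | exact: hM].
have kcv : cvgn (series k).
  apply: normed_cvg.
  apply: (series_le_cvg _ _ _ (@is_cvg_geometric_series _ 1 t _)) => [n|n|n|].
  - exact: normr_ge0.
  - by rewrite /= mul1r exprn_ge0.
  - by rewrite /= mul1r; exact: kt.
  - by rewrite ger0_norm.
have E n : (k * a) n * Num.sqrt (n.+1%:R : R) =
    \sum_(0 <= i < n.+1) k i * ((fpsX ^+ i * a) n * Num.sqrt n.+1%:R).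
  rewrite fpsME mulr_suml big_mkord; apply: eq_bigr => i _.
  by rewrite fpsXnM -ltnS ltn_ord mulrA.
rewrite /asym; under eq_fun do rewrite E.
have -> : L * limn (series k) = limn (series (fun i => k i * L)).
  have -> : series (fun i => k i * L) = (fun n => L * series k n).
    by apply/funext => n; rewrite /series /= mulr_sumr; apply: eq_bigr => i _;
      rewrite mulrC.
  by apply/esym/cvg_lim => //; apply: cvgMr.
apply: (@tannery _ _ (fun i => M * (i.+1%:R * t ^+ i))).
- by move=> i; apply: cvgMr; apply/asymXn.
- move=> n i; rewrite fpsXnM; case: leqP => [le_in|_]; last first.
    by rewrite mul0r mulr0 normr0 !mulr_ge0 ?exprn_ge0.
  have le_sqrt : Num.sqrt (n.+1%:R : R) <= i.+1%:R * Num.sqrt (n - i).+1%:R.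
    rewrite -(@ler_pXn2r _ 2) ?nnegrE ?sqrtr_ge0 ?mulr_ge0 ?sqrtr_ge0 //.
    rewrite exprMn !sqr_sqrtr // -natrX -natrM ler_nat.
    by rewrite -[in leqLHS](subnK le_in) -mulnn; move: (n - i)%N => j; nia.
  have t0i : 0 <= t ^+ i by rewrite exprn_ge0.
  have := hM (n - i)%N; rewrite normrM (ger0_norm (sqrtr_ge0 _)) => hMi.
  rewrite !normrM (ger0_norm (sqrtr_ge0 _)).
  apply: le_trans (_ : t ^+ i * (`|a (n - i)%N| * (i.+1%:R * Num.sqrt (n -
    i).+1%:R)) <= _).
    apply: ler_pM => //.
    by rewrite ler_wpM2l.
  rewrite [leLHS](_ : _ = i.+1%:R * t ^+ i * (`|a (n - i)%N| * Num.sqrt (n -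
    i).+1%:R)); last by ring.
  by rewrite [leRHS]mulrC ler_wpM2l // mulr_ge0.
- have -> : series (fun i => M * (i.+1%:R * t ^+ i)) =
      (fun n => M * series (fun i => i.+1%:R * t ^+ i) n).
    by apply/funext => n; rewrite /series /= mulr_sumr.
  apply/cvg_ex; eexists; apply: cvgMr; exact: (cvg_arith_geom t0 t1).
Qed.

(** The binomial series of (1 - (x w)^d)^(-1/2). *)
Definition invsqrt (x : R) (d : nat) : fps R :=
  fun n => if (d %| n)%N then cbin R (n %/ d) * x ^+ n else 0.

(** With y = (x w)^d, the recurrence of [cbin] says 2 (1 - y) [euler f] = d y f. Hence [euler] kills
    (1 - y) f^2, which is therefore its constant coefficient 1. *)
Lemma invsqrtE x d : (0 < d)%N ->
  (1 - fps_const (x ^+ d) * fpsX ^+ d) * invsqrt x d ^+ 2 = 1.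
Proof.
move=> d0; set f := invsqrt x d; set y := fps_const (x ^+ d) * fpsX ^+ d.
have ey : euler y = fps_const d%:R * y.
  by rewrite eulerM euler_const mul0r add0r eulerXn mulrCA.
have e1 : euler (1 : fps R) = 0 by exact: (euler_const 1).
have ef : fps_const 2 * ((1 - y) * euler f) = fps_const d%:R * y * f.
  apply/fpsP => n; rewrite fps_constM mulrBl mul1r fpsD fpsN -!mulrA
    !fps_constM !fpsXnM.
  rewrite /euler /f /invsqrt; case: leqP => [le_dn|lt_nd]; last first.
    rewrite !mulr0 subr0; case: ifP => [dn|]; last by rewrite !mulr0.
    have [->|n0] := posnP n; first by rewrite mul0r mulr0.
    by move: lt_nd; rewrite ltnNge (dvdn_leq n0 dn).
  rewrite dvdn_subl //; case: ifP => [/dvdnP[q def_n]|];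
    last by rewrite !mulr0 subr0 mulr0.
  move: le_dn; rewrite {}def_n; case: q => [|q _]; first by rewrite leqNgt d0.
  have -> : (q.+1 * d - d = q * d)%N by rewrite mulSn addKn.
  rewrite !mulnK // cbinS.
  have q0 : (q.+1.*2%:R : R) != 0 by rewrite pnatr_eq0.
  have -> : x ^+ (q.+1 * d) = x ^+ d * x ^+ (q * d) by rewrite mulSn exprD.
  rewrite -!muln2 !natrM -natr1 -(natr1 (q * 2)%N) natrM.
  have q1 : q%:R + 1 != 0 :> R by rewrite natr1 pnatr_eq0.
  by field.
have eg : euler ((1 - y) * f ^+ 2) = 0.
  rewrite expr2 eulerM eulerM (_ : euler (1 - y) = - (fps_const d%:R * y));
    last first.
    by rewrite -mulN1r eulerD eulerM -ey e1 -(rmorphN1 fps_const) euler_const;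
      ring.
  transitivity (f * (fps_const 2 * ((1 - y) * euler f) - fps_const d%:R * y * f)).
    by rewrite (rmorph_nat fps_const 2); ring.
  by rewrite ef; ring.
apply/fpsP => -[|n].
  have y0 : y 0%N = 0.
    by rewrite /y fps_constM -[fpsX ^+ d]mulr1 fpsXnM leqNgt d0 mulr0.
  have f0 : f 0%N = 1 by rewrite /f /invsqrt dvdn0 div0n expr0 mulr1.
  rewrite expr2 fpsME big_ord1 fpsD fpsN y0 subnn fpsME big_ord1 subnn f0 fps1E.
  by rewrite /= subr0 !mulr1.
have := congr1 (@^~ n.+1) eg; rewrite /= /euler fps0E => /eqP.
by rewrite mulf_eq0 pnatr_eq0 /= => /eqP ->.
Qed.

Lemma invsqrt_bound (x : R) d n : 0 <= x -> `|invsqrt x d n| <= x ^+ n.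
Proof.
move=> x0; rewrite /invsqrt; case: ifP => _; last by rewrite normr0 exprn_ge0.
rewrite normrM !ger0_norm ?exprn_ge0 // ?(ltW (cbin_gt0 _ _)) //.
by rewrite ler_piMl ?exprn_ge0 ?cbin_le1.
Qed.

(** The odd coefficients of [invsqrt 1 2] vanish, so it has no constant of its own; the factor 1 + w
    copies each even coefficient to the next odd index. *)
Lemma asym_base : asym ((1 + fpsX) * invsqrt 1 2) (Num.sqrt (2 / pi)).
Proof.
rewrite /asym; suff -> : (1 + fpsX) * invsqrt 1 2 = (fun n => cbin R n./2).
  exact: cbin_half_cvg.
apply/fpsP => n; rewrite mulrDl mul1r fpsD fpsXM /invsqrt.
case: n => [|n]; first by rewrite dvdn0 div0n /= expr0 mulr1 addr0.
rewrite !dvdn2 /= negbK !expr1n !mulr1 !divn2.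
by case: ifP => [|on] /=; rewrite ?addr0 // add0r uphalf_half on.
Qed.

Lemma asym_unique a L L' : asym a L -> asym a L' -> L = L'.
Proof. by move=> h h'; apply: (cvg_unique _ h h'). Qed.

(* The sum k of the coefficients of [invsqrt x d] is found without computing
   it: multiplying twice by [invsqrt x d] and once by its inverse square
   preserves a sequence, whence k ^ 2 (1 - x ^ d) = 1. *)
Lemma asym_invsqrt (x : R) d a L : (0 < d)%N -> 0 <= x -> x < 1 -> asym a L ->
  asym (invsqrt x d * a) (L / Num.sqrt (1 - x ^+ d)).
Proof.
move=> d0 x0 x1; set k := limn (series (invsqrt x d)).
have mulk b L' : asym b L' -> asym (invsqrt x d * b) (L' * k).
  by apply: (asym_mul x0 x1) => n; exact: invsqrt_bound.
have xd : 0 < 1 - x ^+ d by rewrite subr_gt0 exprn_ilt1 // -lt0n.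
suff -> : (Num.sqrt (1 - x ^+ d))^-1 = k by exact: mulk.
have k2 : k ^+ 2 * (1 - x ^+ d) = 1.
  set s := Num.sqrt (2 / pi : R).
  have s0 : s != 0 by rewrite gt_eqF // sqrtr_gt0 divr_gt0 ?pi_gt0.
  apply: (mulfI s0); rewrite mulr1.
  have h := mulk _ _ (mulk _ _ asym_base).
  have := asymD h (asymN (@asymZ (x ^+ d) _ _ ((asymXn d _ _).2 h))).
  set B := (1 + fpsX) * _; set J := invsqrt x d.
  have -> : J * (J * B) - fps_const (x ^+ d) * (fpsX ^+ d * (J * (J * B))) = B.
    rewrite -[RHS]mul1r -(invsqrtE x d0) -/J.
    by move: (fps_const _) J B => c J B; ring.
  by move=> h1; rewrite [RHS](asym_unique asym_base h1) -/s;
    move: (k : R) => k'; ring.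
have k0 : 0 <= k.
  have kcv : cvgn (series (invsqrt x d)).
    apply: normed_cvg.
    apply: (series_le_cvg _ _ _ (@is_cvg_geometric_series _ 1 x _)) => [n|n|n|].
    - exact: normr_ge0.
    - by rewrite /= mul1r exprn_ge0.
    - by rewrite /= mul1r; exact: invsqrt_bound.
    - by rewrite ger0_norm.
  apply: limr_ge => //; apply: nearW => n; apply: sumr_ge0 => i _.
  by rewrite /invsqrt; case: ifP => // _;
    rewrite mulr_ge0 ?exprn_ge0 // ltW ?cbin_gt0.
have r0 : Num.sqrt (1 - x ^+ d) != 0 by rewrite gt_eqF // sqrtr_gt0.
apply: (mulIf r0); rewrite mulVf //.
rewrite -[k]ger0_norm // -sqrtr_sqr -sqrtrM ?sqr_ge0 // k2 sqrtr1 //.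
Qed.
End Asymptotics.

(** * The linear system of the generating functions *)

Section GeneratingFunctions.
Variable R : realType.
Implicit Types (a b : fps R) (L : R).

Definition rho : R := (Num.sqrt 5 - 1) / 2.

Lemma sqrt5E : Num.sqrt 5 = 2 * rho + 1 :> R.
Proof. by rewrite /rho; field. Qed.

Lemma rho_sqr : rho ^+ 2 = 1 - rho.
Proof.
have : Num.sqrt 5 ^+ 2 = 5 :> R by rewrite sqr_sqrtr.
rewrite sqrt5E !expr2; nra.
Qed.

Lemma rho_gt0 : 0 < rho.
Proof.
by rewrite divr_gt0 // subr_gt0 -[ltLHS]sqrtr1 ltr_sqrt // ltr1n.
Qed.

Lemma rho_lt1 : rho < 1.
Proof. by rewrite -subr_gt0 -rho_sqr exprn_gt0 ?rho_gt0. Qed.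

Lemma rho_neq0 : rho != 0.
Proof. by rewrite gt_eqF ?rho_gt0. Qed.

Definition fpsz : fps R := fps_const rho * fpsX.

Lemma fpszXE d : fpsz ^+ d = fps_const (rho ^+ d) * fpsX ^+ d.
Proof. by rewrite exprMn rmorphXn. Qed.

Lemma fpszXM d a n :
  (fpsz ^+ d * a) n = if (d <= n)%N then rho ^+ d * a (n - d)%N else 0.
Proof.
by rewrite fpszXE -mulrA fps_constM fpsXnM; case: ifP; rewrite ?mulr0.
Qed.

Lemma fpszM a n : (fpsz * a) n = if n is n1.+1 then rho * a n1 else 0.
Proof. by rewrite -[fpsz]expr1 fpszXM; case: n => // n; rewrite subSS subn0. Qed.

Lemma fpsz2M a n :
  (fpsz ^+ 2 * a) n = if n is n2.+2 then rho ^+ 2 * a n2 else 0.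
Proof. by rewrite fpszXM; case: n => [|[|n]]; rewrite //= subSS subSS subn0. Qed.

Lemma fpszX_inj d a : fpsz ^+ d * a = 0 -> a = 0.
Proof.
move=> h; apply/fpsP => n; have := congr1 (@^~ (n + d)%N) h.
rewrite /= fpszXM leq_addl addnK !fps0E => /eqP.
by rewrite mulf_eq0 expf_eq0 (negPf rho_neq0) andbF => /eqP.
Qed.

Lemma asymz d a L : asym a L -> asym (fpsz ^+ d * a) (rho ^+ d * L).
Proof. by move=> ha; rewrite fpszXE -mulrA; apply: asymZ; apply/asymXn. Qed.

Lemma asymz_inv d a L : asym (fpsz ^+ d * a) L -> asym a (L / rho ^+ d).
Proof.
move=> h; apply/(asymXn d); have := asymZ (x := rho ^- d) h.
rewrite [L / _]mulrC fpszXE -[_ * _ * a]mulrA mulrA -rmorphM mulVf ?rmorph1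
  ?mul1r //.
by rewrite expf_neq0 // rho_neq0.
Qed.

Lemma asym_binom (x : R) d a L : asym a L ->
  asym ((1 + fps_const x * fpsz ^+ d) * a) ((1 + x * rho ^+ d) * L).
Proof.
move=> ha; rewrite !mulrDl !mul1r -!mulrA; apply: asymD => //.
by apply: asymZ; apply: asymz.
Qed.

Definition gf (u : nat -> nat) : fps R := fun n => (u n)%:R * rho ^+ n.

Definition upgf h := gf (nonneg_count true h).
Definition downgf h := gf (nonneg_count false h).

Lemma upgfE h : upgf h = 1 + fpsz * downgf h.+2 + fpsz ^+ 2 * downgf h.+1.
Proof.
apply/fpsP => n; rewrite !fpsD fpszM fpsz2M fps1E /upgf /downgf /gf.
case: n => [|[|n]]; first by rewrite /= mul1r !addr0.
  by rewrite /= !addn0 add0r addr0 expr1 expr0 !mul1r mulr1.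
rewrite nonneg_count_upSS [n.+2 == 0%N]/= natrD add0r mulrDl.
by rewrite !exprS expr0; ring.
Qed.

Lemma downgf0 : downgf 0 = 1.
Proof.
apply/fpsP => -[|[|n]]; rewrite /downgf /gf fps1E /= ?mul0r //.
by rewrite expr0 mul1r.
Qed.

Lemma downgf1 : downgf 1 = 1 + fpsz ^+ 2 * upgf 0.
Proof.
apply/fpsP => n; rewrite !fpsD fpsz2M fps1E /upgf /downgf /gf.
case: n => [|[|n]]; first by rewrite /= mul1r !addr0.
  by rewrite /= mul0r addr0.
by rewrite nonneg_count_down1 [n.+2 == 0%N]/= add0r !exprS expr0; ring.
Qed.

Lemma downgfSS h :
  downgf h.+2 = 1 + fpsz * upgf h + fpsz ^+ 2 * upgf h.+1.
Proof.
apply/fpsP => n; rewrite !fpsD fpszM fpsz2M fps1E /upgf /downgf /gf.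
case: n => [|[|n]]; first by rewrite /= mul1r !addr0.
  by rewrite /= !addn0 add0r addr0 expr1 expr0 !mul1r mulr1.
rewrite nonneg_count_downSS [n.+2 == 0%N]/= natrD add0r mulrDl.
by rewrite !exprS expr0; ring.
Qed.

(** First-step equations after elimination of the paths starting down. An up-down pair has weight
    z^2 or z^4 if it keeps the height and z^3 if it changes it by 1 or -1; 1 + z + z^2 accounts for
    paths of at most one step. *)
Definition up_system (V : nat -> fps R) :=
  V 0 = (1 + fpsz + fpsz ^+ 2) + (fpsz ^+ 2 + fpsz ^+ 4) * V 0 + fpsz ^+ 3 * V 1
  /\ forall h, V h.+1 = (1 + fpsz + fpsz ^+ 2) +
    (fpsz ^+ 2 + fpsz ^+ 4) * V h.+1 + fpsz ^+ 3 * (V h.+2 + V h).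

Lemma up_system_upgf : up_system upgf.
Proof.
split=> [|h]; rewrite [LHS]upgfE !downgfSS ?downgf1; ring.
Qed.

(** Every unknown on the right carries a positive power of z, so the coefficients of index n, at all
    heights at once, are fixed by those of smaller index. *)
Lemma up_system_unique V W : up_system V -> up_system W -> V =1 W.
Proof.
move=> [V0 VS] [W0 WS] h; apply/fpsP => n; have [k] := ubnP n.
elim: k => // k IH in h n *; rewrite ltnS => le_nk.
have E (i : nat) (a b : fps R) : (forall m, (m < n)%N -> a m = b m) ->
    (fpsz ^+ i.+1 * a) n = (fpsz ^+ i.+1 * b) n.
  move=> ab; rewrite !fpszXM; case: leqP => // lt_in; rewrite ab //.
  by rewrite ltn_subrL (leq_trans _ lt_in).
have IH' h' m : (m < n)%N -> V h' m = W h' m.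
  by move=> lt_mn; apply: IH; exact: leq_trans lt_mn le_nk.
case: h => [|h].
  rewrite V0 W0 !mulrDl !fpsD; congr (_ + (_ + _) + _); apply: E => m lt;
    exact: IH'.
rewrite VS WS !mulrDl !mulrDr !fpsD.
by congr (_ + (_ + _) + (_ + _)); apply: E => m lt; exact: IH'.
Qed.

End GeneratingFunctions.

(** * Solution of the system *)

(** The relation q^2 = 1 - q makes 1 - z - z^2 and 1 + z - z^2 split into linear factors in x; the
    J's then cancel against the factors whose inverse roots they are. *)
Lemma sqrt_ratio_identity (A : comNzRingType) (q x z J1 J2 J3 J4 : A) :
  q ^+ 2 = 1 - q -> z = q * x ->
  (1 - x ^+ 2) * J1 ^+ 2 = 1 -> (1 - q ^+ 4 * x ^+ 2) * J2 ^+ 2 = 1 ->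
  (1 - q ^+ 2 * x ^+ 2) * J3 ^+ 2 = 1 -> (1 - q ^+ 6 * x ^+ 6) * J4 ^+ 2 = 1 ->
  ((1 - q * z) * ((1 - z) * ((1 + z ^+ 3) *
    (J2 * (J3 * (J4 * ((1 + x) * J1))))))) ^+ 2 *
    (1 - (z + z ^+ 2) ^+ 2) = 1 - (z - z ^+ 2) ^+ 2.
Proof.
move=> q2 zE h1 h2 h3 h4.
have f1 : 1 - (z + z ^+ 2) ^+ 2 = (1 - x) * (1 + q ^+ 2 * x) * (1 + z + z ^+ 2).
  transitivity ((1 - q * x - q ^+ 2 * x ^+ 2) * (1 + z + z ^+ 2)).
    by rewrite zE; ring.
  by congr (_ * _); rewrite q2; ring.
have f2 : 1 - (z - z ^+ 2) ^+ 2 = (1 + x) * (1 - q ^+ 2 * x) * (1 - z + z ^+ 2).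
  transitivity ((1 + q * x - q ^+ 2 * x ^+ 2) * (1 - z + z ^+ 2)).
    by rewrite zE; ring.
  by congr (_ * _); rewrite q2; ring.
rewrite {}f1 {}f2.
transitivity ((1 + x) * (1 - q ^+ 2 * x) * (1 - z + z ^+ 2) *
  ((1 - x ^+ 2) * J1 ^+ 2) * ((1 - q ^+ 4 * x ^+ 2) * J2 ^+ 2) *
  ((1 - q ^+ 2 * x ^+ 2) * J3 ^+ 2) * ((1 - q ^+ 6 * x ^+ 6) * J4 ^+ 2)).
  by rewrite zE; ring.
by rewrite h1 h2 h3 h4; ring.
Qed.

Section Solution.
Variable R : realType.
Local Notation rho := (rho R).
Local Notation z := (@fpsz R).
Local Notation p := (fps_const rho : fps R).
Local Notation w := (fpsX : fps R).

Definition discr_den : fps R := 1 - (z + z ^+ 2) ^+ 2.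
Definition discr_num : fps R := 1 - (z - z ^+ 2) ^+ 2.

(* discr_den = (1 - w) (1 + rho^2 w) (1 - z^3) / (1 - z) and
   discr_num = (1 + w) (1 - rho^2 w) (1 + z^3) / (1 + z); this series is the
   square root of their quotient, numerator and denominator having been
   multiplied so as to leave only factors of the form 1 - (x w)^d under the
   root. *)
Definition sqrt_ratio : fps R :=
  (1 - p * z) * ((1 - z) * ((1 + z ^+ 3) *
  (invsqrt (rho ^+ 2) 2 * (invsqrt rho 2 * (invsqrt rho 6 *
  ((1 + w) * invsqrt 1 2)))))).

Lemma sqrt_ratioE : sqrt_ratio ^+ 2 * discr_den = discr_num.
Proof.
apply: sqrt_ratio_identity => //.
- by rewrite -rmorphXn rho_sqr rmorphB rmorph1.
- by have := @invsqrtE R 1 2 isT; rewrite expr1n rmorph1 mul1r.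
- by have := @invsqrtE R (rho ^+ 2) 2 isT; rewrite -exprM rmorphXn.
- by have := @invsqrtE R rho 2 isT; rewrite rmorphXn.
- by have := @invsqrtE R rho 6 isT; rewrite rmorphXn.
Qed.

Lemma fpsM0 (a b : fps R) : (a * b) 0%N = a 0%N * b 0%N.
Proof. by rewrite fpsME big_ord1. Qed.

Lemma sqrt_ratio0 : sqrt_ratio 0%N = 1.
Proof.
have J0 x d : invsqrt x d 0%N = 1 :> R.
  by rewrite /invsqrt dvdn0 div0n expr0 mulr1.
have z0 : z 0%N = 0 by rewrite -[z]mulr1 fpszM.
rewrite /sqrt_ratio !fpsM0 !fpsD !fpsN !fpsM0 !exprS !fpsM0 z0 !J0.
by rewrite !fps1E !(mulr0, mul0r, subr0, addr0, mul1r).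
Qed.

(** Since E - D = 4 z^3, the series [sqrt_ratio ^+ 2 - 1] starts at order 3, and so does
    [sqrt_ratio - 1], which can thus be divided by z^3. *)
Lemma sqrt_ratio12 : sqrt_ratio 1%N = 0 /\ sqrt_ratio 2%N = 0.
Proof.
pose Q := sqrt_ratio ^+ 2 - 1.
have QE : Q = z ^+ 2 * Q + z ^+ 3 * (2 * (Q + 2) + z * Q).
  have : sqrt_ratio ^+ 2 = Q + 1 by rewrite /Q; ring.
  move: sqrt_ratioE => + e; rewrite e /discr_den /discr_num => h.
  transitivity ((1 - (z - z ^+ 2) ^+ 2) - (Q + 1) * (1 - (z + z ^+ 2) ^+ 2) +
    Q); first by rewrite h; ring.
  ring.
have Q0 : Q 0%N = 0 by rewrite QE fpsD !fpszXM addr0.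
have Q1 : Q 1%N = 0 by rewrite QE fpsD !fpszXM addr0.
have Q2 : Q 2%N = 0 by rewrite QE fpsD !fpszXM /= subnn Q0 mulr0 addr0.
have S0 := sqrt_ratio0.
have S1 : sqrt_ratio 1%N = 0.
  have : Q 1%N = 2 * sqrt_ratio 1%N.
    rewrite /Q expr2 fpsD fpsN fps1E fpsME !big_ord_recl big_ord0 /= !S0; ring.
  by rewrite Q1 => /esym /eqP; rewrite mulf_eq0 pnatr_eq0 /= => /eqP.
split=> //.
have : Q 2%N = 2 * sqrt_ratio 2%N.
  rewrite /Q expr2 fpsD fpsN fps1E fpsME !big_ord_recl big_ord0 /= !S0 !S1; ring.
by rewrite Q2 => /esym /eqP; rewrite mulf_eq0 pnatr_eq0 /= => /eqP.
Qed.

(** The series B of the overview: the index shift and [rho ^+ 3] divide by z^3 = rho^3 w^3. *)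
Definition motzkin : fps R := fun n => sqrt_ratio (n + 3)%N / (2 * rho ^+ 3).

Lemma motzkinE : z ^+ 3 * (2 * motzkin) = sqrt_ratio - 1.
Proof.
have [S1 S2] := sqrt_ratio12; have S0 := sqrt_ratio0.
apply/fpsP => n; rewrite fpszXM fpsD fpsN fps1E.
case: n => [|[|[|n]]] /=; rewrite ?S0 ?S1 ?S2 ?subrr ?subr0 //.
rewrite -(rmorph_nat fps_const 2) fps_constM /motzkin subSS subSS subSS subn0
  addn3.
field; exact: rho_neq0.
Qed.

(** Squaring 1 + 2 z^3 B = sqrt (E / D) and using E - D = 4 z^3 gives the relation multiplied by 4
    z^3, which can be cancelled. *)
Lemma motzkin_quadratic :
  discr_den * motzkin + z ^+ 3 * discr_den * motzkin ^+ 2 = 1.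
Proof.
apply/eqP; rewrite -subr_eq0; apply/eqP.
set K := _ - 1; suff : z ^+ 3 * (fps_const 4 * K) = 0.
  move/fpszX_inj => K0; apply/fpsP => n; have := congr1 (@^~ n) K0.
  by rewrite /= fps_constM !fps0E => /eqP; rewrite mulf_eq0 pnatr_eq0 => /eqP.
have e : sqrt_ratio = 1 + z ^+ 3 * (2 * motzkin) by rewrite motzkinE; ring.
transitivity (sqrt_ratio ^+ 2 * discr_den - discr_den - 4 * z ^+ 3).
  by rewrite (rmorph_nat fps_const 4) e /K; ring.
by rewrite sqrt_ratioE /discr_num /discr_den; ring.
Qed.

(* The small root of z^3 r^2 - (1 - z^2 - z^4) r + z^3 = 0. *)
Definition small_root : fps R := 1 - discr_den * motzkin.

Fixpoint geom_root (h : nat) : fps R :=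
  if h is h'.+1 then 1 + small_root * geom_root h' else 1.

Definition up_solution h : fps R := (1 + z + z ^+ 2) * geom_root h * motzkin.

Lemma up_system_solution : up_system up_solution.
Proof.
have K := motzkin_quadratic.
split=> [|h]; rewrite /up_solution /=; apply/eqP; rewrite -subr_eq0; apply/eqP.
  transitivity ((1 + z + z ^+ 2) *
    (discr_den * motzkin + z ^+ 3 * discr_den * motzkin ^+ 2 - 1)).
    by rewrite /small_root /discr_den; ring.
  by rewrite K subrr mulr0.
set g := geom_root h.
(* The defect of the equation is again a multiple of the quadratic relation; the cofactor 1 - D B g
   = 1 - (1 - r) g is r^(h+1). *)
transitivity ((1 + z + z ^+ 2) *
    (discr_den * motzkin + z ^+ 3 * discr_den * motzkin ^+ 2 - 1) *
    (1 - discr_den * motzkin * g)).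
  rewrite /small_root /discr_den; ring.
by rewrite K subrr mulr0 mul0r.
Qed.

Lemma upgf0E : upgf R 0 = (1 + z + z ^+ 2) * motzkin.
Proof.
apply/fpsP => n.
by rewrite (up_system_unique (@up_system_upgf R) up_system_solution)
  /up_solution mulr1.
Qed.
End Solution.

(** * Asymptotics *)

Section CountAsymptotics.
Variable R : realType.
Local Notation rho := (rho R).
Local Notation z := (@fpsz R).
Implicit Types (a : fps R) (L : R).

Lemma rho_bounds : rho < 2 / 3 /\ 3 / 5 < rho.
Proof.
have h := rho_sqr R; have h0 := rho_gt0 R; rewrite expr2 in h.
split; rewrite ltNge; apply/negP => h1.
  have := ler_pM _ _ h1 h1; lra.
have := ler_pM _ _ h1 h1; lra.
Qed.

(** Wallis' constant times the values of the other factors of [sqrt_ratio] at w = 1: (1 - rho^2) (1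
    - rho) (1 + rho^3) = 2 rho^4, over the roots of 1 - rho^6, 1 - rho^2 and 1 - rho^4, all reduced
    by rho^2 = 1 - rho. *)
Definition sqrt_ratio_const : R :=
  2 * rho ^+ 4 * Num.sqrt (2 / pi) /
  (Num.sqrt (8 * rho - 4) * (Num.sqrt rho * Num.sqrt (3 * rho - 1))).

Lemma asym_sqrt_ratio : asym (sqrt_ratio R) sqrt_ratio_const.
Proof.
have h0 := rho_gt0 R; have h1 := rho_lt1 R.
have h2 : rho ^+ 2 < 1 by rewrite exprn_ilt1 // ltW.
have := @asym_base R.
move/(@asym_invsqrt R rho 6 _ _ isT (ltW h0) h1).
move/(@asym_invsqrt R rho 2 _ _ isT (ltW h0) h1).
move/(@asym_invsqrt R (rho ^+ 2) 2 _ _ isT (exprn_ge0 _ (ltW h0)) h2).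
move/(@asym_binom R 1 3); move/(@asym_binom R (-1) 1);
  move/(@asym_binom R (- rho) 1).
rewrite !rmorphN rmorph1 !expr1 !mul1r !mulN1r mulNr.
congr asym.
rewrite mulNr.
have r2 := rho_sqr R.
have r3 : rho ^+ 3 = 2 * rho - 1 by rewrite exprS r2 mulrBr -expr2 r2; ring.
have -> : 1 - (rho ^+ 2) ^+ 2 = 3 * rho - 1 by rewrite r2 sqrrB r2; ring.
have -> : 1 - rho ^+ 6 = 8 * rho - 4 by rewrite (exprM _ 3 2) r3 sqrrB exprMn
  r2; ring.
have -> : 1 - rho ^+ 2 = rho by rewrite r2; ring.
rewrite /sqrt_ratio_const !invfM.
have -> : 1 + rho ^+ 3 = 2 * rho by rewrite r3; ring.
have -> : 1 - rho = rho ^+ 2 by rewrite r2.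
ring.
Qed.

Definition up_const : R := sqrt_ratio_const / rho ^+ 3.

Lemma asym_const (x : R) : asym (fps_const x) 0.
Proof. by apply: (@asym_finite _ _ 1) => -[]. Qed.

Lemma asym_fpsz d : asym (z ^+ d) 0.
Proof.
by rewrite -[_ ^+ d]mulr1 -(rmorph1 fps_const) -(mulr0 (rho ^+ d));
  apply/asymz/asym_const.
Qed.

Lemma asym_upgf0 : asym (upgf R 0) up_const.
Proof.
have h : asym (2 * motzkin R) (sqrt_ratio_const / rho ^+ 3).
  apply: asymz_inv; rewrite motzkinE -(rmorph1 fps_const) -(subr0
    sqrt_ratio_const).
  exact: asymD asym_sqrt_ratio (asymN (@asym_const _)).
have {}h : asym (motzkin R) (2^-1 * up_const).
  rewrite [motzkin R](_ : _ = fps_const 2^-1 * (2 * motzkin R));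
    first exact: asymZ.
  by rewrite -(rmorph_nat fps_const 2) mulrA -rmorphM mulVf // rmorph1 mul1r.
rewrite upgf0E !mulrDl mul1r.
(* At w = 1 the factor 1 + z + z^2 is 1 + rho + rho^2 = 2, which cancels the 1/2. *)
have := asymD (asymD h (asymz (d := 1) h)) (asymz (d := 2) h).
rewrite expr1 expr1; congr asym; by rewrite rho_sqr; field.
Qed.

(** Solve the system for z^3 times the series of greatest height. As 1 - rho^2 - rho^4 = 2 rho^3,
    the constants satisfy L_1 = 2 L_0 and L_(h+2) = 2 L_(h+1) - L_h, hence form an arithmetic
    progression. *)
Lemma asym_upgf h : asym (upgf R h) (h.+1%:R * up_const).
Proof.
have [e0 eS] := up_system_upgf R.
have c0 : asym (1 + z + z ^+ 2) 0.
  have := asymD (asymD (@asym_const 1) (@asym_fpsz 1)) (@asym_fpsz 2).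
  by rewrite rmorph1 expr1 !addr0.
have r4 : rho ^+ 4 = 2 - 3 * rho.
  by rewrite (exprM _ 2 2) rho_sqr sqrrB rho_sqr; ring.
have r3 : rho ^+ 3 = 2 * rho - 1 by rewrite exprS rho_sqr mulrBr -expr2
  rho_sqr; ring.
suff: asym (upgf R h) (h.+1%:R * up_const) /\ asym (upgf R h.+1) (h.+2%:R *
  up_const) by case.
elim: h => [|h [IH0 IH1]].
  have h0 := asym_upgf0; split; first by rewrite mul1r.
  have := asymD (asymD (asymD h0 (asymN c0)) (asymN (asymz (d := 2) h0)))
    (asymN (asymz (d := 4) h0)).
  set t := _ - _ => ht.
  have {ht} : asym (z ^+ 3 * upgf R 1) (rho ^+ 3 * (2 * up_const)).
    move: ht; congr asym; first by rewrite /t {1}e0; ring.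
    by rewrite r3 rho_sqr r4; ring.
  move/asymz_inv; congr asym; by field; exact: rho_neq0.
split=> //.
have := asymD (asymD (asymD (asymD IH1 (asymN c0)) (asymN (asymz (d := 2)
  IH1))) (asymN (asymz (d := 4) IH1)))
  (asymN (asymz (d := 3) IH0)).
set t := _ - _ => ht.
have {ht} : asym (z ^+ 3 * upgf R h.+2) (rho ^+ 3 * (h.+3%:R * up_const)).
  move: ht; congr asym; first by rewrite /t {1}eS; ring.
  by rewrite r3 rho_sqr r4 -!natr1; ring.
move/asymz_inv; congr asym; by field; exact: rho_neq0.
Qed.

(** For m >= 1, paths starting up contribute m + 1 and those starting down rho (m - 1) + rho^2 m,
    which add up to 2 m + rho^2. For m = 0 no nonempty path starts down. *)
Definition above_const (m : nat) : R := if m == 0%N then 1 else 2 * m%:R + rho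
  ^+ 2.

Lemma asym_above m : asym (upgf R m + downgf R m) (above_const m * up_const).
Proof.
case: m => [|[|m]].
- rewrite downgf0 -(rmorph1 fps_const) -[_ * _]addr0 mul1r.
  exact: asymD asym_upgf0 (@asym_const _).
- rewrite downgf1 -(rmorph1 fps_const).
  have := asymD (@asym_upgf 1) (asymD (@asym_const 1) (asymz (d := 2)
    (@asym_upgf 0))).
  by congr asym; rewrite /above_const /=; ring.
rewrite downgfSS -(rmorph1 fps_const).
have := asymD (@asym_upgf m.+2) (asymD (asymD (@asym_const 1) (asymz (d := 1)
  (@asym_upgf m))) (asymz (d := 2) (@asym_upgf m.+1))).
by rewrite expr1; congr asym; rewrite expr1 /above_const /= rho_sqr -!natr1; ring.
Qed.

(** Scaled by rho^n, the Fibonacci recurrence has characteristic roots 1 and -rho^2, so Binet's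
    formula is a constant plus a vanishing geometric term. *)
Lemma compositions_cvg :
  (fun n => (compositions n)%:R * rho ^+ n) @ \oo --> (1 + rho ^+ 2)^-1.
Proof.
have r2 := rho_sqr R; have h0 := rho_gt0 R; have h1 := rho_lt1 R.
have q0 : 1 + rho ^+ 2 != 0 by rewrite gt_eqF // ltr_pwDl // exprn_ge0 // ltW.
have rec n : (compositions n.+1)%:R * rho ^+ n.+1 =
    1 - rho ^+ 2 * ((compositions n)%:R * rho ^+ n).
  elim: n => [|n IH]; first by rewrite /= addn0 !mul1r expr0 mulr1 expr1 r2; ring.
  have -> : compositions n.+2 = (compositions n.+1 + compositions n)%N by [].
  rewrite natrD mulrDl.
  have -> : (compositions n.+1)%:R * rho ^+ n.+2 =
    rho * ((compositions n.+1)%:R * rho ^+ n.+1) by rewrite [rho ^+ n.+2]exprS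
      mulrCA.
  have -> : (compositions n)%:R * rho ^+ n.+2 = 1 - (compositions n.+1)%:R *
    rho ^+ n.+1.
    by rewrite IH !exprS; ring.
  by rewrite r2; ring.
have E n : (compositions n)%:R * rho ^+ n =
    (1 + rho ^+ 2)^-1 + geometric (1 - (1 + rho ^+ 2)^-1) (- rho ^+ 2) n.
  elim: n => [|n IH]; first by rewrite /= !expr0; ring.
  rewrite rec IH /= [(- rho ^+ 2) ^+ n.+1]exprS; move: ((- rho ^+ 2) ^+ n) => g.
  by field.
under eq_fun do rewrite E.
set c := _^-1; have g0 : geometric (1 - c) (- rho ^+ 2) @ \oo --> 0.
  apply: cvg_geometric; rewrite normrN ger0_norm ?exprn_ge0 ?(ltW h0) //.
  by rewrite exprn_ilt1 // ltW.
suff: (fun n => c + geometric (1 - c) (- rho ^+ 2) n) @ \oo --> c + 0.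
  by rewrite addr0.
by apply: cvgD => //; exact: cvg_cst.
Qed.

Lemma above_constE m :
  above_const m * up_const * (1 + rho ^+ 2) / 2 = c_ R m.
Proof.
have r2 := rho_sqr R; have h0 := rho_gt0 R; have h1 := rho_lt1 R.
have [h2 h3] := rho_bounds; have pi0 := pi_gt0 R.
have r0 := rho_neq0 R; have pin0 : (pi : R) != 0 by rewrite gt_eqF.
have s5 := sqrt5E R.
have C0 : up_const * (1 + rho ^+ 2) / 2 =
    (2 + Num.sqrt 5) / 2 * Num.sqrt ((7 * Num.sqrt 5 - 15) / pi).
  rewrite s5 /up_const /sqrt_ratio_const.
  have r3 : rho ^+ 3 = 2 * rho - 1 by rewrite exprS r2 mulrBr -expr2 r2; ring.
  clear s5; move: rho r2 r3 h0 h1 h2 h3 r0 => x r2 r3 h0 h1 h2 h3 r0.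
  move: (pi : R) pi0 pin0 => P pi0 pin0.
  (* Both sides are nonnegative; squaring removes the roots and leaves a rational identity modulo
     x^2 = 1 - x. *)
  apply/eqP; rewrite -(@eqrXn2 _ 2) //; first last.
  - by rewrite mulr_ge0 ?sqrtr_ge0 //; lra.
  - have h0' := ltW h0; have q0 : 0 <= 1 + x ^+ 2 by rewrite addr_ge0 ?exprn_ge0.
    by do ![exact: h0' | exact: q0 | exact: ler0n | rewrite invr_ge0
      | exact: sqrtr_ge0 | apply: exprn_ge0 | apply: mulr_ge0].
  apply/eqP.
  rewrite !(exprMn, exprVn) !sqr_sqrtr; try lra; last 2 first.
  - by rewrite divr_ge0 ?(ltW pi0) //; lra.
  - by rewrite divr_ge0 ?(ltW pi0) //.
  have d1 : 8 * x - 4 != 0 by rewrite gt_eqF //; lra.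
  have d2 : 3 * x - 1 != 0 by rewrite gt_eqF //; lra.
  have e1 : (1 + x ^+ 2) ^+ 2 = 5 - 5 * x.
    rewrite r2; transitivity (4 - 4 * x + x ^+ 2); [ring | rewrite r2; ring].
  have e2 : (2 + (2 * x + 1)) ^+ 2 = 8 * x + 13.
    transitivity (4 * x ^+ 2 + 12 * x + 9); [ring | rewrite r2; ring].
  have e3 : (8 * x - 4) * (3 * x - 1) = 28 - 44 * x.
    transitivity (24 * x ^+ 2 - 20 * x + 4); [ring | rewrite r2; ring].
  have e4 : (8 * x + 13) * (14 * x - 8) * (28 - 44 * x) = 40 * (2 * x - 1).
    transitivity (- 4928 * x * x ^+ 2 - 2056 * x ^+ 2 + 7880 * x - 2912);
      first by ring.
    rewrite r2; transitivity (4928 * x ^+ 2 + 5008 * x - 4968); first by ring.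
    by rewrite r2; ring.
  rewrite e1 e2.
  transitivity (2 * (x * (5 - 5 * x)) / ((8 * x - 4) * (3 * x - 1)) / P).
    by field; rewrite ?d1 ?d2 ?r0 ?pin0.
  rewrite e3 (_ : x * (5 - 5 * x) = 5 * x - 5 * x ^+ 2); last by ring.
  have d3 : 28 - 44 * x != 0 by rewrite -e3 mulf_neq0.
  transitivity ((8 * x + 13) * (14 * x - 8) * (28 - 44 * x) / (4 * (28 - 44 *
    x)) / P).
    by rewrite e4 r2; field; rewrite ?d3 ?pin0.
  by field; rewrite ?d3 ?pin0.
rewrite /above_const /c_ -mulrA -mulrA [up_const * _]mulrA C0 s5.
case: eqP => // _; first by rewrite mul1r.
rewrite r2 mulrA; congr (_ * _); set x := rho in r2 h0 h3 *.
have d : 2 * x + 1 - 2 != 0 by rewrite gt_eqF //; lra.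
(* Here 2 x + 3 = sqrt 5 + 2 and 2 x - 1 = sqrt 5 - 2 have product 1, which trades the factor of the
   case m = 0 for the denominator of the case m >= 1. *)
transitivity ((2 * (2 * m%:R + 1 - x) * ((2 * x + 3) * (2 * x - 1))) / (4 * (2
  * x + 1 - 2))).
  by field.
have -> : (2 * x + 3) * (2 * x - 1) = 1.
  transitivity (4 * x ^+ 2 + 4 * x - 3); [ring | rewrite r2; ring].
by field.
Qed.

Lemma prob_above_cvg m :
  (fun n => prob_above R m n * Num.sqrt n%:R) @ \oo --> c_ R m.
Proof.
have h0 := rho_gt0 R.
have q0 : 0 < 1 + rho ^+ 2 by rewrite ltr_pwDl // exprn_ge0 // ltW.
have qi : (1 + rho ^+ 2)^-1 != 0 by rewrite invr_eq0 gt_eqF.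
(* The powers of rho cancel in A / T, and q turns the root of n + 2 from [asym] into that of n + 1.
   The shift by one avoids size 0. *)
pose A n := (upgf R m + downgf R m) n.+1 * Num.sqrt (n.+2%:R : R).
pose T n := (compositions n.+1)%:R * rho ^+ n.+1.
pose q n := Num.sqrt (n.+2%:R : R) / Num.sqrt n.+1%:R.
have H1 : A @ \oo --> above_const m * up_const.
  by have := @asym_above m; rewrite /asym -cvg_shiftS.
have H2 : T @ \oo --> (1 + rho ^+ 2)^-1.
  by have := compositions_cvg; rewrite -cvg_shiftS.
have H3 : q @ \oo --> (1 : R) := @cvg_sqrt_ratio R.
rewrite -above_constE -(cvg_shiftS (fun n => prob_above R m n * _)).
have -> : [sequence prob_above R m n.+1 * Num.sqrt n.+1%:R]_n =
    (fun n => A n * (T n)^-1 * 2^-1 * (q n)^-1).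
  apply/funext => n; rewrite [LHS]/= prob_aboveE // /A /T /q fpsD /upgf /downgf
    /gf natrD.
  have s1 := @sqrtS_neq0 R n; have s2 := @sqrtS_neq0 R n.+1.
  have r0 : rho ^+ n.+1 != 0 by rewrite expf_neq0 // gt_eqF.
  have c0 : (compositions n.+1)%:R != 0 :> R.
    by rewrite pnatr_eq0 -lt0n compositions_gt0.
  rewrite -muln2 natrM.
  move: (nonneg_count true m n.+1)%:R (nonneg_count false m n.+1)%:R => x y.
  move: (compositions n.+1)%:R c0 (rho ^+ n.+1) r0 => c c0 r r0.
  move: (Num.sqrt n.+1%:R) s1 (Num.sqrt n.+2%:R) s2 => t t0 s s0.
  by field; rewrite ?c0 ?r0 ?t0 ?s0.
have <- : above_const m * up_const * (1 + rho ^+ 2)^-1^-1 / 2 / 1 =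
    above_const m * up_const * (1 + rho ^+ 2) / 2 by rewrite invrK divr1.
apply: cvgM (cvgV (oner_neq0 _) H3).
by apply: cvgM (cvg_cst _); exact: cvgM H1 (cvgV qi H2).
Qed.

Lemma c_gt0 m : 0 < c_ R m.
Proof.
have pi0 := pi_gt0 R.
have s2 : 2 < Num.sqrt 5 :> R.
  by rewrite -[ltLHS]ger0_norm // -sqrtr_sqr ltr_sqrt // -natrX ltr_nat.
have s3 : 15 / 7 < Num.sqrt 5 :> R.
  rewrite -[ltLHS]ger0_norm // -sqrtr_sqr ltr_sqrt // expr_div_n ltr_pdivrMr //.
  by rewrite -!natrX -natrM ltr_nat.
have s4 : Num.sqrt 5 < 3 :> R.
  by rewrite -[ltRHS]ger0_norm // -sqrtr_sqr ltr_sqrt // -natrX ltr_nat.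
have K0 : 0 < Num.sqrt ((7 * Num.sqrt 5 - 15) / pi) :> R.
  by rewrite sqrtr_gt0 divr_gt0 //; lra.
rewrite /c_; case: eqP => m0; rewrite mulr_gt0 // divr_gt0 //; try lra.
have : 0 <= m%:R :> R by rewrite ler0n.
have : 1 <= m%:R :> R by rewrite ler1n lt0n; apply/eqP.
lra.
Qed.

End CountAsymptotics.

Theorem corollary4p1 (R : realType) (m : nat) :
  (fun n : nat => prob_above R m n : R^o) ~_\oo
  (fun n : nat => c_ R m / Num.sqrt (n%:R : R) : R^o).
Proof.
apply/eqaddoP => e e0.
have c0 := @c_gt0 R m.
(* The equivalence demands an error relative to c_m / sqrt n, hence the tolerance e c_m, positive by
   [c_gt0]. *)
have /cvgrPdist_le/(_ (e * c_ R m)) := @prob_above_cvg R m.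
rewrite mulr_gt0 // => /(_ isT) h.
near=> n.
have n0 : 0 < Num.sqrt n%:R :> R.
  by rewrite sqrtr_gt0 ltr0n; near: n; exact: nbhs_infty_gt.
rewrite !fctE /= normrM normfV (ger0_norm (ltW c0)) (gtr0_norm n0).
rewrite mulrA ler_pdivlMr // -{2}(gtr0_norm n0) -normrM mulrBl divfK ?gt_eqF //.
by rewrite distrC; near: n; exact: h.
Unshelve. all: by end_near.
Qed.
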